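(* Let $G$ be an infinite finitely generated group and let $S_1$ and $S_2$ be two finite generating sets of $G$. Then \begin{itemize} \item $\mathrm{SDP}(G,S_1)\equiv_p \mathrm{SDP}(G,S_2)$, \item $\mathrm{RDP}(G,S_1)\equiv_p \mathrm{RDP}(G,S_2)$. \end{itemize}
   Context: Let $S$ be a finite generating set of $G$. For a finite alphabet $A$, a nearest neighbor pattern (with respect to $S$) is a tuple $(a,b,s)$ with $a,b\in A$, $s\in S$; it appears in $x\in A^G$ if there is $g\in G$ with $x(g)=a$ and $x(gs)=b$. For a finite set $\mathcal F$ of nearest neighbor patterns, $X_{\mathcal F}\subseteq A^G$ is the set of configurations $x:G\to A$ in which no pattern of $\mathcal F$ appears. Seeded domino problem $\mathrm{SDP}(G,S)$: given a finite alphabet $A$, a finite set $\mathcal F$ of nearest neighbor forbidden patterns and a letter $a_0\in A$, determine whether there is $x\in X_{\mathcal F}$ with $x(1_G)=a_0$. Recurrent domino problem $\mathrm{RDP}(G,S)$: same input; determine whether there is $x\in X_{\mathcal F}$ such that $\{g\in G: x(g)=a_0\}$ is infinite. Decision problems are identified with the languages of (encodings of) their yes instances. For languages $L,L'$, $L\leq_p L'$ ($L$ positive-reduces to $L'$) means that for any input $w$ one can compute finitely many finite sets $F_1(w),\dots,F_n(w)$ such that $w\in L$ if and only if there is $i\in\{1,\dots,n\}$ with $F_i(w)\subseteq L'$. We write $L\equiv_p L'$ if $L\leq_p L'$ and $L'\leq_p L$. *)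

(* Defs.v *)
From mathcomp Require Import all_boot.
From mathcomp Require Import boolp classical_sets cardinality.

Set Implicit Arguments.
Unset Strict Implicit.
Unset Printing Implicit Defensive.

Local Open Scope classical_set_scope.
Local Open Scope group_scope.

(* Words are first-order data built from natural numbers by pairing and
   listing, so that no Goedel numbering has to be fixed. *)
Inductive dtype : Type :=
  | DNat
  | DPair of dtype & dtype
  | DSeq of dtype.

Fixpoint data (D : dtype) : eqType :=
  match D with
  | DNat => nat
  | DPair D1 D2 => (data D1 * data D2)%type
  | DSeq D1 => seq (data D1)
  end.

(* The total computable functions, as Kleene's general recursive functions:
   the least class of functions containing the basic ones and closed under
   composition, pairing, primitive recursion (on numbers and on lists) and
   minimization of regular functions, i.e., those for which the search always
   succeeds.  Recursion and minimization are given by their defining equations.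
   By Kleene's normal form theorem, every total recursive function arises using
   only regular minimizations, so partial functions are not needed. *)
Inductive computable : forall D E : dtype, (data D -> data E) -> Prop :=
  | computable_ext D E (f g : data D -> data E) :
      f =1 g -> computable f -> computable g
  | computable_id D : computable (fun x : data D => x)
  | computable_comp D E K (f : data D -> data E) (g : data E -> data K) :
      computable f -> computable g -> computable (fun x => g (f x))
  | computable_pair D E K (f : data D -> data E) (g : data D -> data K) :
      computable f -> computable g ->
      @computable D (DPair E K) (fun x => (f x, g x))
  | computable_fst D E : @computable (DPair D E) D (fun x => x.1)
  | computable_snd D E : @computable (DPair D E) E (fun x => x.2)
  | computable_zero D : @computable D DNat (fun=> 0%N)
  | computable_succ : @computable DNat DNat succn
  | computable_nil D E : @computable D (DSeq E) (fun=> [::])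
  | computable_cons D :
      @computable (DPair D (DSeq D)) (DSeq D) (fun x => x.1 :: x.2)
  | computable_natrec D E (f : data D -> data E)
        (g : data (DPair (DPair D DNat) E) -> data E)
        (h : data (DPair D DNat) -> data E) :
      computable f -> computable g ->
      (forall x, h (x, 0%N) = f x) ->
      (forall x n, h (x, n.+1) = g (x, n, h (x, n))) ->
      computable h
  | computable_seqrec D E K (f : data D -> data K)
        (g : data (DPair (DPair D (DPair E (DSeq E))) K) -> data K)
        (h : data (DPair D (DSeq E)) -> data K) :
      computable f -> computable g ->
      (forall x, h (x, [::]) = f x) ->
      (forall x y s, h (x, y :: s) = g (x, (y, s), h (x, s))) ->
      computable h
  | computable_min D (f : data (DPair D DNat) -> data DNat)
        (m : data D -> data DNat) :
      computable f ->
      (forall x, f (x, m x) = 0%N) ->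
      (forall x n, (n < m x)%N -> f (x, n) <> 0%N) ->
      computable m.

Definition language (D : dtype) : Type := set (data D).

(* [R w] lists the finite sets F_1(w), ..., F_n(w), each given as a list. *)
Definition pos_reduces (D E : dtype) (L : language D) (L' : language E) : Prop :=
  exists R : data D -> data (DSeq (DSeq E)),
    computable R /\
    forall w, L w <-> exists2 F : seq (data E), F \in R w & [set` F] `<=` L'.

Definition pos_equiv (D E : dtype) (L : language D) (L' : language E) : Prop :=
  pos_reduces L L' /\ pos_reduces L' L.

(* A finite subset S of G is listed by a sequence, whose order only serves to
   number the elements of S in encodings of inputs. *)
Definition generates (G : groupType) (S : seq G) : Prop :=
  forall H : {pred G}, group_closed H -> {subset S <= H} -> forall g, g \in H.

Section Patterns.
Variables (G : groupType) (S : seq G).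

(* [seq_sub S] is the finite type of the elements of S. *)
Definition nn_pattern (A : finType) : Type := (A * A * seq_sub S)%type.

Definition appears (A : finType) (p : nn_pattern A) (x : G -> A) : Prop :=
  let: (a, b, s) := p in exists g : G, x g = a /\ x (g * val s) = b.

Definition subshift (A : finType) (F : seq (nn_pattern A)) : set (G -> A) :=
  [set x | forall p, p \in F -> ~ appears p x].

(* Inputs of the domino problems; up to renaming of the letters, the finite
   alphabet is {0, ..., n - 1}. *)
Record input : Type := Input {
  alphabet_size : nat;
  forbidden : seq (nn_pattern 'I_alphabet_size);
  seed : 'I_alphabet_size
}.

Definition sdp_yes (I : input) : Prop :=
  exists2 x, subshift (forbidden I) x & x 1 = seed I.

Definition rdp_yes (I : input) : Prop :=
  exists2 x, subshift (forbidden I) x & infinite_set [set g | x g = seed I].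

Definition input_dtype : dtype :=
  DPair (DPair DNat (DSeq (DPair (DPair DNat DNat) DNat))) DNat.

Definition encode (I : input) : data input_dtype :=
  (alphabet_size I,
   [seq (val p.1.1, val p.1.2, index (val p.2) S) | p <- forbidden I],
   val (seed I)).

(* In particular, words that do not encode any input are not in the
   languages. *)
Definition SDP : language input_dtype := [set encode I | I in sdp_yes].
Definition RDP : language input_dtype := [set encode I | I in rdp_yes].

End Patterns.

(* Main.v *)
Require Import Defs.
From mathcomp Require Import all_boot.
From mathcomp Require Import boolp classical_sets cardinality.

(* Choose a finite list l of elements of G that contains 1 and S1 and is linked
   by left multiplications by elements of S2.  A configuration x over n letters
   is recoded by z(g) = (x(g h))_{h in l}, a letter below n^|l| read in base n.
   That the blocks of z overlap coherently is a nearest neighbor condition with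
   respect to S2, since x(g t h) occurs both in z(g) at t h and in z(g t) at h;
   that x avoids the patterns over S1 can be read off each single block.  The
   letter a0 is replaced by the finitely many blocks p with letter a0 at 1, and
   the answer is "some p is a yes instance": if x takes the value a0 at 1
   (infinitely often), then z takes one of the values p at 1 (infinitely
   often).  The seeded and the recurrent problems are treated at once, as
   "{g | x(g) = a0} satisfies Q" for an upward closed and partition regular
   property Q that fails for the empty set. *)

Set Implicit Arguments.
Unset Strict Implicit.
Unset Printing Implicit Defensive.

(** * Closure properties of the computable functions *)

Lemma computable_comp2 D E1 E2 K (f1 : data D -> data E1) (f2 : data D -> data E2)
    (g : data (DPair E1 E2) -> data K) :
  computable g -> computable f1 -> computable f2 ->
  computable (fun x => g (f1 x, f2 x)).
Proof. by move=> cg c1 c2; exact: computable_comp (computable_pair c1 c2) cg. Qed.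

Lemma computable_app2 D E1 E2 K (g : data E1 -> data E2 -> data K)
    (f1 : data D -> data E1) (f2 : data D -> data E2) :
  @computable (DPair E1 E2) K (fun z => g z.1 z.2) -> computable f1 -> computable f2 ->
  computable (fun x => g (f1 x) (f2 x)).
Proof. exact: computable_comp2. Qed.

Lemma computable_proj1 D E K (f : data D -> data (DPair E K)) :
  computable f -> @computable D E (fun x => (f x).1).
Proof. by move=> cf; exact: computable_comp cf (computable_fst E K). Qed.

Lemma computable_proj2 D E K (f : data D -> data (DPair E K)) :
  computable f -> @computable D K (fun x => (f x).2).
Proof. by move=> cf; exact: computable_comp cf (computable_snd E K). Qed.

Lemma computable_S D (f : data D -> data DNat) :
  computable f -> @computable D DNat (fun x => (f x).+1).
Proof. by move=> cf; exact: computable_comp cf computable_succ. Qed.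

Lemma computable_consf D E (f : data D -> data E) (s : data D -> data (DSeq E)) :
  computable f -> computable s -> @computable D (DSeq E) (fun x => f x :: s x).
Proof. exact: computable_comp2 (computable_cons E). Qed.

Lemma computable_const D E (c : data E) : computable (fun=> c : data E) (D := D).
Proof.
elim: E c => [n|E1 IH1 E2 IH2 [c1 c2]|E IH].
- elim: n => [|n IHn]; first exact: computable_zero.
  exact: (computable_S IHn).
- exact: (computable_pair (IH1 c1) (IH2 c2)).
elim=> [|c s IHs]; first exact: computable_nil.
exact: (computable_consf (IH c) IHs).
Qed.

(** Primitive recursion in curried form, with the number of rounds itself computed from the
    argument; the arithmetic below is built on it. *)
Lemma computable_natrecf D E (f : data D -> data E)
    (g : data (DPair (DPair D DNat) E) -> data E)
    (h : data D -> nat -> data E) (m : data D -> data DNat) :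
  computable f -> computable g ->
  (forall x, h x 0 = f x) -> (forall x n, h x n.+1 = g (x, n, h x n)) ->
  computable m -> computable (fun x => h x (m x)).
Proof.
move=> cf cg h0 hS cm.
apply: (@computable_comp2 D D DNat E id m (fun z => h z.1 z.2)) cm.
  exact: computable_natrec cf cg _ _.
exact: computable_id.
Qed.

Lemma computable_foldr D E K (g : data D -> data E -> data K -> data K)
    (f : data D -> data K) (s : data D -> data (DSeq E)) :
  @computable (DPair D (DPair E K)) K (fun z => g z.1 z.2.1 z.2.2) ->
  computable f -> computable s ->
  computable (fun x => foldr (g x) (f x) (s x)).
Proof.
move=> cg cf cs.
apply: (@computable_comp2 D D (DSeq E) K id s
          (fun z => foldr (g z.1) (f z.1) z.2)) cs; last exact: computable_id.
pose T := DPair (DPair D (DPair E (DSeq E))) K.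
have c1 : @computable T (DPair D (DPair E (DSeq E))) (fun z => z.1) by exact: computable_fst.
have c2 : @computable T K (fun z => z.2) by exact: computable_snd.
have c12 := computable_proj2 c1.
apply: (@computable_seqrec D E K f (fun z => g z.1.1 z.1.2.1 z.2)) => //.
exact: (computable_comp
  (computable_pair (computable_proj1 c1) (computable_pair (computable_proj1 c12) c2)) cg).
Qed.

(* Since [data] reduces to plain product types, unification cannot recover the
   [dtype] of a chain of projections; it is recomputed from the domain. *)
Ltac dtype_of D h :=
  lazymatch h with
  | (fun x => x) => constr:(D)
  | @fst _ _ => lazymatch eval hnf in D with DPair ?A _ => constr:(A) end
  | @snd _ _ => lazymatch eval hnf in D with DPair _ ?B => constr:(B) end
  | (fun x => fst (@?k x)) =>
      let T := dtype_of D k in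
      lazymatch eval hnf in T with DPair ?A _ => constr:(A) end
  | (fun x => snd (@?k x)) =>
      let T := dtype_of D k in
      lazymatch eval hnf in T with DPair _ ?B => constr:(B) end
  end.

Ltac computable_var :=
  lazymatch goal with
  | |- @computable ?D _ (fun x => x) => exact (@computable_id D)
  | |- @computable ?D _ (@fst _ _) =>
      lazymatch eval hnf in D with DPair ?A ?B => exact (@computable_fst A B) end
  | |- @computable ?D _ (@snd _ _) =>
      lazymatch eval hnf in D with DPair ?A ?B => exact (@computable_snd A B) end
  | |- @computable ?D _ (fun x => fst (@?k x)) =>
      let T := dtype_of D k in
      lazymatch eval hnf in T with DPair ?A ?B =>
        apply (@computable_proj1 D A B k); computable_var end
  | |- @computable ?D _ (fun x => snd (@?k x)) =>
      let T := dtype_of D k in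
      lazymatch eval hnf in T with DPair ?A ?B =>
        apply (@computable_proj2 D A B k); computable_var end
  end.

(** * Arithmetic *)

Lemma computable_addn D (f g : data D -> data DNat) :
  computable f -> computable g -> @computable D DNat (fun x => f x + g x).
Proof.
move=> cf cg; apply: (@computable_natrecf D DNat f (fun z => z.2.+1)
  (fun x n => f x + n)) => //.
- by apply: computable_S; computable_var.
- by move=> x; rewrite addn0.
- by move=> x n; rewrite addnS.
Qed.

Lemma computable_muln D (f g : data D -> data DNat) :
  computable f -> computable g -> @computable D DNat (fun x => f x * g x).
Proof.
move=> cf cg; apply: (@computable_natrecf D DNat (fun=> 0) (fun z => f z.1.1 + z.2)
  (fun x n => f x * n)) => //.
- exact: computable_zero.
- apply: computable_addn; last by computable_var.
  by apply: (computable_comp _ cf); computable_var.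
- by move=> x; rewrite muln0.
- by move=> x n; rewrite mulnS.
Qed.

Lemma computable_expn D (f g : data D -> data DNat) :
  computable f -> computable g -> @computable D DNat (fun x => f x ^ g x).
Proof.
move=> cf cg; apply: (@computable_natrecf D DNat (fun=> 1) (fun z => f z.1.1 * z.2)
  (fun x n => f x ^ n)) => //.
- exact: computable_const.
- apply: computable_muln; last by computable_var.
  by apply: (computable_comp _ cf); computable_var.
- by move=> x n; rewrite expnS.
Qed.

Lemma computable_predn D (f : data D -> data DNat) :
  computable f -> @computable D DNat (fun x => (f x).-1).
Proof.
move=> cf; apply: (@computable_natrecf D DNat (fun=> 0) (fun z => z.1.2)
  (fun x n => n.-1)) => //; first exact: computable_zero.
by computable_var.
Qed.

Lemma computable_subn D (f g : data D -> data DNat) :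
  computable f -> computable g -> @computable D DNat (fun x => f x - g x).
Proof.
move=> cf cg; apply: (@computable_natrecf D DNat f (fun z => z.2.-1)
  (fun x n => f x - n)) => //.
- by apply: computable_predn; computable_var.
- by move=> x; rewrite subn0.
- by move=> x n; rewrite subnS.
Qed.

(** A recursion of length 0 or 1: the base value is [g], and the step forgets the previous value and
    returns [f]. *)
Lemma computable_if D E (b : data D -> bool) (f g : data D -> data E) :
  @computable D DNat (fun x => nat_of_bool (b x)) -> computable f -> computable g ->
  computable (fun x => if b x then f x else g x).
Proof.
move=> cb cf cg.
apply: (@computable_ext _ _ (fun x => if nat_of_bool (b x) is 0 then g x else f x)).
  by move=> x; case: (b x).
apply: (@computable_natrecf D E g (fun z => f z.1.1)
  (fun x n => if n is 0 then g x else f x)) => //.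
by apply: (computable_comp _ cf); computable_var.
Qed.

(** Booleans are not among the data types, so a decidable predicate is computed as a number 0 or
    1. *)
Definition computable_pred D (b : data D -> bool) : Prop :=
  @computable D DNat (fun x => nat_of_bool (b x)).

Lemma computable_negb D (b : data D -> bool) :
  computable_pred b -> computable_pred (fun x => ~~ b x).
Proof.
move=> cb; apply: computable_ext (computable_subn (computable_const D (E := DNat) 1) cb).
by move=> x; case: (b x).
Qed.

Lemma computable_andb D (b c : data D -> bool) :
  computable_pred b -> computable_pred c -> computable_pred (fun x => b x && c x).
Proof.
move=> cb cc; apply: computable_ext (computable_muln cb cc) => x.
by rewrite mulnb.
Qed.

Lemma computable_orb D (b c : data D -> bool) :
  computable_pred b -> computable_pred c -> computable_pred (fun x => b x || c x).
Proof.
move=> cb cc.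
apply: computable_ext (computable_negb (computable_andb (computable_negb cb) (computable_negb cc))).
by move=> x; rewrite negb_and !negbK.
Qed.

Lemma computable_leq D (f g : data D -> data DNat) :
  computable f -> computable g -> computable_pred (fun x => f x <= g x).
Proof.
move=> cf cg; apply: computable_ext
  (computable_subn (computable_const D (E := DNat) 1) (computable_subn cf cg)).
by move=> x; rewrite /leq; case: (f x - g x).
Qed.

Lemma computable_eqn D (f g : data D -> data DNat) :
  computable f -> computable g -> @computable_pred D (fun x => f x == g x).
Proof.
move=> cf cg; apply: computable_ext
  (computable_andb (computable_leq cf cg) (computable_leq cg cf)).
by move=> x; rewrite eqn_leq.
Qed.

(** Recursion on the dividend: the remainder grows by one and is reset to 0 when it reaches the
    divisor. *)
Lemma computable_modn D (f g : data D -> data DNat) :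
  computable f -> computable g -> @computable D DNat (fun x => f x %% g x).
Proof.
move=> cf cg.
apply: (@computable_natrecf D DNat (fun=> 0)
  (fun z => if z.2.+1 == g z.1.1 then 0 else z.2.+1) (fun x n => n %% g x)) => //.
- exact: computable_zero.
- apply: computable_if; [apply: computable_eqn|exact: computable_zero|].
  + by apply: computable_S; computable_var.
  + by apply: (computable_comp _ cg); computable_var.
  + by apply: computable_S; computable_var.
- by move=> x; rewrite mod0n.
(* For divisor 0 the remainder is the dividend itself, and the reset never occurs. *)
move=> x n; rewrite modnS; case: (posnP (g x)) => [->|g0]; first by rewrite dvd0n.
rewrite [in LHS](divn_eq n (g x)) -addnS /dvdn modnMDl.
have := ltn_pmod n g0; rewrite leq_eqVlt => /orP[/eqP E|lt].
  by rewrite E modnn !eqxx.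
by rewrite modn_small // (ltn_eqF lt) modnMDl modn_mod.
Qed.

(** Passing from [n] to [n.+1] raises the quotient by one exactly when the divisor divides [n.+1].
    For divisor 0 the test always fails, in accordance with [n %/ 0 = 0]. *)
Lemma computable_divn D (f g : data D -> data DNat) :
  computable f -> computable g -> @computable D DNat (fun x => f x %/ g x).
Proof.
move=> cf cg.
apply: (@computable_natrecf D DNat (fun=> 0)
  (fun z => (z.1.2.+1 %% g z.1.1 == 0) + z.2) (fun x n => n %/ g x)) => //.
- exact: computable_zero.
- apply: computable_addn; last by computable_var.
  apply: computable_eqn; last exact: computable_zero.
  apply: computable_modn.
  + by apply: computable_S; computable_var.
  + by apply: (computable_comp _ cg); computable_var.
- by move=> x; rewrite div0n.
move=> x n; case: (posnP (g x)) => [->|g0]; first by rewrite !divn0 modn0.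
by rewrite divnS.
Qed.

(** * Operations on lists *)

Lemma computable_has D E (b : data D -> data E -> bool) (s : data D -> data (DSeq E)) :
  @computable_pred (DPair D E) (fun z => b z.1 z.2) -> computable s ->
  computable_pred (fun x => has (b x) (s x)).
Proof.
move=> cb cs.
apply: (@computable_ext _ DNat
  (fun x => foldr (fun y r => nat_of_bool (b x y || (r != 0))) 0 (s x))).
  by move=> x; elim: (s x) => //= y t ->; case: (b x y) => //=; case: has.
apply: (@computable_foldr D E DNat
  (fun x y r => nat_of_bool (b x y || (r != 0)))) cs; last exact: computable_zero.
apply: computable_orb; last first.
  by apply/computable_negb/computable_eqn; [computable_var|exact: computable_zero].
by apply: (@computable_app2 _ D E DNat b _ _ cb); computable_var.
Qed.

Lemma computable_all D E (b : data D -> data E -> bool) (s : data D -> data (DSeq E)) :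
  @computable_pred (DPair D E) (fun z => b z.1 z.2) -> computable s ->
  computable_pred (fun x => all (b x) (s x)).
Proof.
move=> cb cs; apply: computable_ext
  (computable_negb (@computable_has D E (fun x y => ~~ b x y) s (computable_negb cb) cs)).
by move=> x; rewrite has_predC negbK.
Qed.

Lemma computable_map D E K (f : data D -> data E -> data K) (s : data D -> data (DSeq E)) :
  @computable (DPair D E) K (fun z => f z.1 z.2) -> computable s ->
  @computable D (DSeq K) (fun x => [seq f x y | y <- s x]).
Proof.
move=> cf cs.
apply: (@computable_foldr D E (DSeq K) (fun x y r => f x y :: r)) cs; last exact: computable_nil.
apply: computable_consf; last by computable_var.
by apply: (@computable_app2 _ D E K f _ _ cf); computable_var.
Qed.

Lemma computable_filter D E (b : data D -> data E -> bool) (s : data D -> data (DSeq E)) :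
  @computable_pred (DPair D E) (fun z => b z.1 z.2) -> computable s ->
  @computable D (DSeq E) (fun x => [seq y <- s x | b x y]).
Proof.
move=> cb cs.
apply: (@computable_ext _ (DSeq E)
  (fun x => foldr (fun y (r : data (DSeq E)) => if b x y then y :: r else r) [::] (s x))).
  by move=> x; elim: (s x) => //= y t ->.
apply: (@computable_foldr D E (DSeq E)
  (fun x y (r : data (DSeq E)) => if b x y then y :: r else r)) cs; last exact: computable_nil.
apply: computable_if; [|apply: computable_consf|]; try by computable_var.
by apply: (@computable_app2 _ D E DNat b _ _ cb); computable_var.
Qed.

Lemma computable_cat D E (s t : data D -> data (DSeq E)) :
  computable s -> computable t -> @computable D (DSeq E) (fun x => s x ++ t x).
Proof.
move=> cs ct.
apply: (@computable_ext _ (DSeq E) (fun x => foldr cons (t x) (s x))).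
  by move=> x; elim: (s x) => //= y r ->.
apply: (@computable_foldr D E (DSeq E) (fun x y r => y :: r)) => //.
by apply: computable_consf; computable_var.
Qed.

Lemma computable_flatten D E (s : data D -> data (DSeq (DSeq E))) :
  computable s -> @computable D (DSeq E) (fun x => flatten (s x)).
Proof.
move=> cs.
apply: (@computable_foldr D (DSeq E) (DSeq E) (fun x y r => y ++ r)) => //.
  by apply: computable_cat; computable_var.
exact: computable_nil.
Qed.

Lemma computable_allpairs D E K (s : data D -> data (DSeq E)) (t : data D -> data (DSeq K)) :
  computable s -> computable t ->
  @computable D (DSeq (DPair E K)) (fun x => [seq (a, b) | a <- s x, b <- t x]).
Proof.
move=> cs ct; apply: computable_flatten.
apply: (@computable_map D E (DSeq (DPair E K)) (fun x a => [seq (a, b) | b <- t x])) => //.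
apply: (@computable_map (DPair D E) K (DPair E K) (fun z b => (z.2, b))).
  by apply: computable_pair; computable_var.
by apply: (computable_comp _ ct); computable_var.
Qed.

(** Drop [n x] entries by iterating [behead], then take the head by a fold that ignores its
    accumulator; the base value 0 of the fold is the default of [nth]. *)
Lemma computable_nth D (s : data D -> data (DSeq DNat)) (n : data D -> data DNat) :
  computable s -> computable n -> @computable D DNat (fun x => nth 0 (s x) (n x)).
Proof.
move=> cs cn.
apply: (@computable_ext _ DNat (fun x => foldr (fun y _ => y) 0 (drop (n x) (s x)))).
  by move=> x; rewrite -[n x in RHS]addn0 -nth_drop; case: drop.
apply: (@computable_foldr D DNat DNat (fun x y r => y)); first by computable_var.
  exact: computable_zero.
apply: (@computable_natrecf D (DSeq DNat) s
  (fun z => behead z.2) (fun x m => drop m (s x))) cn => //.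
- pose T := DPair (DPair D DNat) (DSeq DNat).
  have c1 : @computable T (DSeq DNat) (fun z => z.2) by computable_var.
  apply: (@computable_comp2 T T (DSeq DNat) (DSeq DNat) id _ (fun z => behead z.2)) c1;
    last exact: computable_id.
  apply: (@computable_seqrec T DNat (DSeq DNat) (fun=> [::]) (fun z => z.1.2.2)) => //.
    exact: computable_nil.
  by computable_var.
- by move=> x; rewrite drop0.
- by move=> x m; rewrite -drop1 drop_drop add1n.
Qed.

(** The recursion puts the newest number in front, whence the reversal. It is harmless: only
    membership in these lists matters later. *)
Lemma computable_rev_iota D (n : data D -> data DNat) :
  computable n -> @computable D (DSeq DNat) (fun x => rev (iota 0 (n x))).
Proof.
move=> cn.
apply: (@computable_natrecf D (DSeq DNat) (fun=> [::]) (fun z => z.1.2 :: z.2)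
  (fun x m => rev (iota 0 m))) => //.
- exact: computable_nil.
- by apply: computable_consf; computable_var.
- by move=> x m; rewrite -addn1 iotaD rev_cat.
Qed.

(** * The reduction on words and its computability *)

(** The base [n] digit of [p] at place [j], place 0 being the least significant. *)
Definition digit (n j p : nat) : nat := (p %/ n ^ j) %% n.

Lemma computable_digit D (n j p : data D -> data DNat) :
  computable n -> computable j -> computable p ->
  @computable D DNat (fun x => digit (n x) (j x) (p x)).
Proof.
move=> cn cj cp; apply: computable_modn => //; apply: computable_divn => //.
exact: computable_expn.
Qed.

(* An element (j, t, i) of C asks that the digit j of the block at g equal the
   digit i of the block at g t, where t is an index into the target generators;
   T lists the positions in a block of the source generators; J1 and J2 are the
   valid indices of source and target generators. *)
Section Reduction.
Variables (k : nat) (C : seq (nat * nat * nat)) (T J1 J2 : seq nat).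

Local Notation triple := (DPair (DPair DNat DNat) DNat).

(** Recognizes the words that encode inputs, since all others must be rejected. *)
Definition well_formed (J : seq nat) (w : data input_dtype) : bool :=
  (w.2 < w.1.1) &&
  all (fun q : nat * nat * nat => [&& q.1.1 < w.1.1, q.1.2 < w.1.1 & has (eq_op q.2) J])
    w.1.2.

(** The first disjunct is an incoherent overlap of two neighboring blocks. The second is a source
    pattern visible inside the left block alone; such a block is then forbidden beside every
    neighbor. *)
Definition incompatible (w : data input_dtype) (u : data triple) : bool :=
  has (fun c => (c.1.2 == u.2) && (digit w.1.1 c.1.1 u.1.1 != digit w.1.1 c.2 u.1.2)) C ||
  has (fun q : nat * nat * nat => (digit w.1.1 0 u.1.1 == q.1.1) &&
         (digit w.1.1 (nth 0 T q.2) u.1.1 == q.1.2)) w.1.2.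

Definition block_letters (w : data input_dtype) : seq nat := rev (iota 0 (w.1.1 ^ k)).

Definition block_forbidden (w : data input_dtype) : data (DSeq triple) :=
  [seq u <- [seq (a, b) | a <- [seq (a, b) | a <- block_letters w, b <- block_letters w],
                          b <- J2] | incompatible w u].

(** Each finite set is a singleton, one for each block whose digit 0 is the old seed. A malformed
    word gets no set at all, hence the answer no. *)
Definition block_reduction (w : data input_dtype) : data (DSeq (DSeq input_dtype)) :=
  if well_formed J1 w then
    [seq [:: (w.1.1 ^ k, block_forbidden w, p)]
       | p <- [seq p <- block_letters w | digit w.1.1 0 p == w.2]]
  else [::].

Lemma computable_well_formed J : computable_pred (well_formed J).
Proof.
apply: computable_andb; first by apply: computable_leq; [apply: computable_S|]; computable_var.
apply: (@computable_all input_dtype triple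
  (fun w q => [&& q.1.1 < w.1.1, q.1.2 < w.1.1 & has (eq_op q.2) J])); last by computable_var.
apply: computable_andb; first by apply: computable_leq; [apply: computable_S|]; computable_var.
apply: computable_andb; first by apply: computable_leq; [apply: computable_S|]; computable_var.
apply: (@computable_has (DPair input_dtype triple) DNat (fun z j => z.2.2 == j) (fun=> J));
  last exact: computable_const.
by apply: computable_eqn; computable_var.
Qed.

Lemma computable_incompatible :
  @computable_pred (DPair input_dtype triple) (fun z => incompatible z.1 z.2).
Proof.
apply: computable_orb.
  apply: (@computable_has (DPair input_dtype triple) triple (fun z c => (c.1.2 == z.2.2) &&
    (digit z.1.1.1 c.1.1 z.2.1.1 != digit z.1.1.1 c.2 z.2.1.2))); last exact: computable_const.
  apply: computable_andb; first by apply: computable_eqn; computable_var.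
  by apply: computable_negb; apply: computable_eqn; apply: computable_digit; computable_var.
apply: (@computable_has (DPair input_dtype triple) triple
  (fun z q => (digit z.1.1.1 0 z.2.1.1 == q.1.1) &&
    (digit z.1.1.1 (nth 0 T q.2) z.2.1.1 == q.1.2))); last by computable_var.
apply: computable_andb; apply: computable_eqn; try by computable_var.
  apply: computable_digit; try by computable_var.
  exact: computable_zero.
apply: computable_digit; try by computable_var.
apply: computable_nth; last by computable_var.
exact: computable_const.
Qed.

Lemma computable_block_size : @computable input_dtype DNat (fun w => w.1.1 ^ k).
Proof.
by apply: computable_expn; [computable_var|exact: computable_const].
Qed.

Lemma computable_block_forbidden : @computable _ (DSeq triple) block_forbidden.
Proof.
have cL := computable_rev_iota computable_block_size.
apply: (computable_filter computable_incompatible).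
apply: (@computable_allpairs _ (DPair DNat DNat) DNat _ (fun=> J2)).
  exact: (computable_allpairs cL cL).
exact: computable_const.
Qed.

Lemma computable_block_reduction : computable block_reduction.
Proof.
apply: (computable_if (computable_well_formed J1)); last exact: computable_nil.
apply: (@computable_map input_dtype DNat (DSeq input_dtype)
  (fun w p => [:: (w.1.1 ^ k, block_forbidden w, p)])).
  apply: (@computable_consf _ input_dtype); last exact: computable_nil.
  apply: computable_pair; last by computable_var.
  apply: (@computable_pair _ DNat (DSeq triple)).
    by apply: (computable_comp _ computable_block_size); computable_var.
  by apply: (computable_comp _ computable_block_forbidden); computable_var.
apply: (@computable_filter input_dtype DNat (fun w p => digit w.1.1 0 p == w.2)).
  apply: computable_eqn; last by computable_var.
  apply: computable_digit; try by computable_var.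
  exact: computable_zero.
exact: (computable_rev_iota computable_block_size).
Qed.

End Reduction.

Local Open Scope group_scope.

(** * Tight lists: coherent blocks come from one configuration *)

Section Tight.
Variable G : groupType.

(** The codes of generators that really occur in encodings: if [S] has repetitions, only first
    positions are used. *)
Definition indices (S : seq G) : seq nat := [seq index s S | s <- S].

Lemma mem_indices (S : seq G) s : s \in S -> index s S \in indices S.
Proof. exact: (map_f (fun s => index s S)). Qed.

Lemma nth_indices (S : seq G) i : i \in indices S -> index (nth 1 S i) S = i /\ nth 1 S i \in S.
Proof. by case/mapP=> s sS ->; rewrite nth_index. Qed.

(* Think of [y g h] as the letter that the block at [g] assigns to the position
   [g * h]. *)
Definition consistent (S l : seq G) (y : G -> G -> nat) : Prop :=
  forall g t h, t \in S -> h \in l -> t * h \in l -> y g (t * h) = y (g * t) h.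

(** Linkedness of [l] to 1 is expressed by its consequence: every consistent family of blocks is
    read off the single configuration [fun g => y g 1]. This avoids handling paths in the Cayley
    graph. *)
Definition tight (S l : seq G) : Prop :=
  forall y, consistent S l y -> forall g h, h \in l -> y g h = y (g * h) 1.

Lemma consistent_sub (S l l' : seq G) y :
  {subset l <= l'} -> consistent S l' y -> consistent S l y.
Proof. by move=> sub cy g t h tS hl thl; apply: cy => //; exact: sub. Qed.

Lemma tight_cat (S l1 l2 : seq G) : tight S l1 -> tight S l2 -> tight S (l1 ++ l2).
Proof.
move=> t1 t2 y cy g h; rewrite mem_cat => /orP[hl|hl].
  by apply: t1 hl; apply: consistent_sub cy => u; rewrite mem_cat => ->.
by apply: t2 hl; apply: consistent_sub cy => u; rewrite mem_cat orbC => ->.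
Qed.

(** Left multiplication by a generator commutes with right multiplication by [h]. *)
Lemma consistent_translate (S l : seq G) y h :
  consistent S [seq u * h | u <- l] y -> consistent S l (fun g u => y g (u * h)).
Proof.
move=> cy g t u tS ul tul; rewrite -mulgA; apply: cy => //; first exact: map_f.
by rewrite mulgA; exact: (map_f (fun u => u * h) tul).
Qed.

Definition tightly_reachable (S : seq G) (g : G) : Prop :=
  exists l, [/\ tight S l, 1 \in l & g \in l].

Lemma tightly_reachable_gen (S : seq G) s : s \in S -> tightly_reachable S s.
Proof.
move=> sS; exists [:: 1; s]; split; rewrite ?inE ?eqxx ?orbT // => y cy g h.
rewrite !inE => /orP[] /eqP ->; first by rewrite mulg1.
by rewrite -[in LHS](mulg1 s) cy ?inE ?mulg1 ?eqxx ?orbT.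
Qed.

(** The translate of [l1] by [h] links [g * h] to [h], and [l2] links [h] to 1. *)
Lemma tightly_reachableM (S : seq G) g h :
  tightly_reachable S g -> tightly_reachable S h -> tightly_reachable S (g * h).
Proof.
move=> [l1 [t1 l1_1 gl1]] [l2 [t2 l2_1 hl2]].
exists (l2 ++ [seq u * h | u <- l1]); split; last first.
- by rewrite mem_cat (map_f (fun u => u * h) gl1) orbT.
- by rewrite mem_cat l2_1.
move=> y cy.
have cy2 : consistent S l2 y by apply: consistent_sub cy => u; rewrite mem_cat => ->.
have cy1 : consistent S l1 (fun g u => y g (u * h)).
  by apply: consistent_translate; apply: consistent_sub cy => u; rewrite mem_cat orbC => ->.
move=> a v; rewrite mem_cat => /orP[vl|/mapP[u ul ->]]; first exact: t2.
by rewrite (t1 _ cy1 a u ul) mul1g (t2 _ cy2 _ h hl2) mulgA.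
Qed.

(** Translating [l] by [g^-1] sends [g] to 1 and 1 to [g^-1]. *)
Lemma tightly_reachableV (S : seq G) g :
  tightly_reachable S g -> tightly_reachable S g^-1.
Proof.
move=> [l [tl l1 gl]]; exists [seq u * g^-1 | u <- l]; split.
- move=> y cy a v /mapP[u ul ->].
  have ty := tl _ (consistent_translate cy).
  (* With 1 written as [g * g^-1], tightness of [l] for the translated family shows that both sides
     equal [y (a * u) g^-1]. *)
  have := ty (a * u * g^-1) g gl; rewrite /= mulgV mulgVK mulgA => ->.
  exact: ty.
- by rewrite -(mulgV g); exact: (map_f (fun u => u * g^-1) gl).
by rewrite -[X in X \in _]mul1g; exact: (map_f (fun u => u * g^-1) l1).
Qed.

(** The tightly reachable elements form a subgroup containing [S]. *)
Lemma generates_tightly_reachable (S : seq G) :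
  generates S -> forall g, tightly_reachable S g.
Proof.
move=> genS g.
have/asboolP// : g \in [pred g | `[< tightly_reachable S g >]].
apply: genS; last by move=> s sS; apply/asboolP; exact: tightly_reachable_gen.
split.
  apply/asboolP; exists [:: 1]; split; rewrite ?inE // => y _ a h.
  by rewrite inE => /eqP ->; rewrite mulg1.
move=> u v /asboolP ru /asboolP rv; apply/asboolP.
by apply: tightly_reachableM => //; exact: tightly_reachableV.
Qed.

(** Tight lists for the single elements of [S'] are concatenated. The head 1 ensures that digit 0 of
    a block is the letter at its center. *)
Lemma generates_tight (S S' : seq G) : generates S ->
  exists l, tight S (1 :: l) /\ {subset S' <= 1 :: l}.
Proof.
move=> genS; elim: S' => [|s S' [l [tl sub]]].
  exists [::]; split=> // y _ a h.
  by rewrite inE => /eqP ->; rewrite mulg1.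
have [l' [tl' l'1 sl']] := generates_tightly_reachable genS s.
exists (l ++ l'); split; first exact: (tight_cat tl tl').
move=> u; rewrite inE => /predU1P[->|/sub]; first by rewrite inE mem_cat sl' !orbT.
by rewrite !inE mem_cat => /orP[->|->]; rewrite ?orbT.
Qed.

(** The empty list generates only the trivial group. A generator is needed later to express
    conditions on one block as nearest neighbor patterns. *)
Lemma generates_neq0 (S : seq G) :
  infinite_set [set: G]%classic -> generates S -> exists s, s \in S.
Proof.
case: S => [|s S]; last by exists s; rewrite mem_head.
move=> infG gen0; case: infG; apply: (sub_finite_set _ (finite_seq [:: 1])) => g _ /=.
apply: gen0 => //; split; first exact: mem_head.
by move=> u v; rewrite !inE => /eqP -> /eqP ->; rewrite mulgV.
Qed.

End Tight.

(** * The two problems in a common form, over the natural numbers *)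

Section Languages.
Variables (G : groupType) (Q : set G -> Prop).

Definition domino (S : seq G) : language input_dtype :=
  [set encode I | I in [set I : input S |
     exists2 x, subshift (forbidden I) x & Q [set g | x g = seed I]]]%classic.

(** Letters and generators become plain numbers, so that alphabets of different sizes need no
    dependent types. *)
Definition nat_domino (S : seq G) (w : data input_dtype) : Prop :=
  well_formed (indices S) w /\
  exists x : G -> nat, [/\ forall g, x g < w.1.1,
    forall q, q \in w.1.2 -> forall g, ~ (x g = q.1.1 /\ x (g * nth 1 S q.2) = q.1.2)
  & Q [set g | x g = w.2]%classic].

Lemma dominoE (S : seq G) w : domino S w <-> nat_domino S w.
Proof.
split=> [[I [x subx Qx] <-]|].
  split.
    rewrite /well_formed /= ltn_ord /=; apply/allP => q /mapP[p pI ->] /=.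
    rewrite !ltn_ord /=; apply/hasP; exists (index (val p.2) S) => //.
    by apply: map_f; exact: valP.
  exists (fun g => val (x g)); split => [g|q /mapP[p pI ->] g /=|]; first exact: ltn_ord.
    rewrite nth_index; last exact: valP.
    case=> /val_inj x1 /val_inj x2; apply: (subx p pI).
    by case: p pI x1 x2 => [[a b] s] pI x1 x2; exists g.
  suff <- : [set g | x g = seed I]%classic =
            [set g | val (x g) = (encode I).2]%classic by [].
  by apply/seteqP; split=> g /= => [->|/val_inj].
case: w => [[n F] a] [/andP[/= an wf] [x [/= xn xF Qx]]].
(* Decode the forbidden patterns one by one: the bounds give ordinals, and a valid index gives an
   element of [S]. *)
have [F' FE] : exists F' : seq (nn_pattern S 'I_n),
    [seq (val p.1.1, val p.1.2, index (val p.2) S) | p <- F'] = F.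
  elim: F wf {xF} => [|[[b c] i] F IH] /=; first by exists [::].
  case/andP=> /and3P[bn cn /hasP[j jS /= /eqP ij]] /IH[F' <-].
  rewrite -ij in jS; have [iE iS] := nth_indices jS.
  by exists ((Ordinal bn, Ordinal cn, SeqSub iS) :: F') => /=; rewrite iE.
exists (Input F' (Ordinal an)); last by rewrite /encode /= FE.
exists (fun g => Ordinal (xn g)).
  move=> [[b c] s] pF' [g [/= xb xc]].
  apply: (xF (val b, val c, index (val s) S)) => /=.
    by rewrite -FE; exact: (map_f _ pF').
  rewrite nth_index; last exact: valP.
  by split; [rewrite -xb|rewrite -xc].
suff <- : [set g | x g = a]%classic =
          [set g | Ordinal (xn g) = Ordinal an]%classic by [].
by apply/seteqP; split=> g /=; [move=> xa; exact: val_inj|case].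
Qed.

End Languages.

(** * Coding blocks as numbers *)

(** Horner evaluation in base [n], least significant digit first. *)
Definition undigits (n : nat) (s : seq nat) : nat := foldr (fun a m => a + n * m)%N 0%N s.

Lemma undigits_lt n s : all (fun a => a < n)%N s -> (undigits n s < n ^ size s)%N.
Proof.
elim: s => [|a s IH] //= /andP[an /IH lt]; rewrite expnS.
apply: (@leq_trans (n * (undigits n s).+1)); last by rewrite leq_mul2l lt orbT.
by rewrite mulnS -addSn leq_add2r.
Qed.

Lemma digit_undigits n s j : all (fun a => a < n)%N s -> (j < size s)%N ->
  digit n j (undigits n s) = nth 0%N s j.
Proof.
elim: s j => [|a s IH] //= [|j] /andP[an sn] js.
  by rewrite /digit expn0 divn1 addnC mulnC modnMDl modn_small.
have n0 : (0 < n)%N by exact: leq_ltn_trans an.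
rewrite /= -IH // /digit expnS divnMA; congr (_ %/ _ %% _)%N.
by rewrite addnC mulnC divnMDl // divn_small // addn0.
Qed.

(** * Correctness of the reduction *)

Definition monotone (T : Type) (Q : set T -> Prop) : Prop :=
  forall A B : set T, (A `<=` B)%classic -> Q A -> Q B.

(** The pigeonhole principle for [Q]: in a coloring with finitely many colors, some color class of
    [A] retains [Q]. *)
Definition partition_regular (T : Type) (Q : set T -> Prop) : Prop :=
  forall (A : set T) (f : T -> nat) N, (forall g, f g < N)%N -> Q A ->
    exists p, Q (A `&` [set g | f g = p])%classic.

Section Correctness.
Variables (G : groupType) (Q : set G -> Prop) (S1 S2 l : seq G).
Hypotheses (Qmono : monotone Q) (Qreg : partition_regular Q)
  (Qne : forall A, Q A -> (A !=set0)%classic).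
Hypotheses (S2_tight : tight S2 l) (S1l : {subset S1 <= l})
  (l1 : 1 \in l) (index1 : index 1 l = 0%N).
Variable s2 : G.
Hypothesis s2S2 : s2 \in S2.

Definition overlaps : seq (nat * nat * nat) :=
  [seq (index (u.1 * u.2) l, index u.1 S2, index u.2 l)
     | u <- [seq (t, v) | t <- S2, v <- l] & u.1 * u.2 \in l].

Definition positions : seq nat := [seq index s l | s <- S1].

Lemma nth_positions i : i \in indices S1 -> nth 0%N positions i = index (nth 1 S1 i) l.
Proof.
move=> /nth_indices[iE iS]; rewrite (nth_map 1) //.
by rewrite -[X in (X < _)%N]iE index_mem.
Qed.

Local Notation R := (block_reduction (size l) overlaps positions (indices S1) (indices S2)).
Local Notation forb := (block_forbidden (size l) overlaps positions (indices S2)).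

Lemma mem_block_forbidden w p q t :
  (p, q, t) \in forb w =
  [&& incompatible overlaps positions w (p, q, t), p < w.1.1 ^ size l, q < w.1.1 ^ size l
    & t \in indices S2]%N.
Proof.
rewrite mem_filter; congr (_ && _).
apply/allpairsP/and3P => [[[[a b] i] [/allpairsP[[a' b'] []]]]|[pn qn tS]].
  rewrite /block_letters !mem_rev !mem_iota /= add0n => an bn [-> ->] iS [-> -> ->].
  by split.
exists ((p, q), t); split=> //; apply/allpairsP; exists (p, q); split=> //=.
  by rewrite mem_rev mem_iota.
by rewrite mem_rev mem_iota.
Qed.

Lemma block_reductionP (w : data input_dtype) :
  nat_domino Q S1 w <->
  well_formed (indices S1) w /\
  exists2 p, (p < w.1.1 ^ size l)%N /\ digit w.1.1 0 p = w.2 &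
    nat_domino Q S2 (w.1.1 ^ size l, forb w, p)%N.
Proof.
case: w => [[n F] a]; split.
  move=> [wf [x [/= xn xF Qx]]]; split=> //.
  (* The block of [x] at [g], as a number. *)
  pose z g := undigits n [seq x (g * u) | u <- l].
  have xa g : all (fun b => b < n)%N [seq x (g * u) | u <- l].
    by apply/allP => ? /mapP[v _ ->].
  have dz g u : u \in l -> digit n (index u l) (z g) = x (g * u).
    move=> uh; rewrite digit_undigits ?size_map ?index_mem //.
    by rewrite (nth_map 1) ?index_mem // nth_index.
  have dz0 g : digit n 0 (z g) = x g by rewrite -index1 dz // mulg1.
  have zn g : (z g < n ^ size l)%N.
    by have := undigits_lt (xa g); rewrite size_map.
  (* Color the occurrences of the seed by their blocks; a class with [Q] supplies the new seed
     [p]. *)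
  have [p Qp] := Qreg zn Qx.
  (* A member of that class shows that digit 0 of [p] is the old seed. *)
  have [g [/= xga zgp]] : ([set g | x g = a] `&` [set g | z g = p] !=set0)%classic.
    exact: Qne.
  exists p; first by rewrite -zgp dz0.
  split.
    rewrite /well_formed /= -zgp zn /=; apply/allP => -[[q r] t].
    rewrite mem_block_forbidden => /and4P[_ -> -> tS] /=.
    by apply/hasP; exists t.
  exists z; split=> //=; last by apply: Qmono Qp => ? [].
  move=> [[q r] t]; rewrite mem_block_forbidden /= => /and4P[+ _ _ /nth_indices[tE tS]].
  move=> + b [zq zr]; rewrite -{}zq -{}zr => /orP[] /hasP[].
    (* An overlap mismatch is impossible: both digits are the value of [x] at [b * (v * u)]. *)
    move=> _ /mapP[[v u] + ->]; rewrite mem_filter /= => /andP[vul].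
    case/allpairsP=> [[v' u'] [/= vS ul [? ?]]]; subst v' u' => /andP[/eqP vt].
    by rewrite !dz // -vt nth_index // mulgA eqxx.
  move=> [[c d] i] iF /= /andP[/eqP]; rewrite dz0 => xc /eqP xd.
  apply: (xF _ iF b) => /=; split=> //; rewrite -xd.
  have /andP[_ /allP/(_ _ iF) /and3P[_ _ /hasP[j jS /eqP /= ij]]] := wf.
  rewrite -ij in jS; rewrite nth_positions // dz //.
  by apply: S1l; have [] := nth_indices jS.
move=> [wf [p [/= pn dp] [wf2 [z [/= zn zF Qz]]]]]; split=> //.
have n0 : (0 < n)%N by case/andP: wf => /= + _; exact: leq_ltn_trans.
pose y g u := digit n (index u l) (z g).
(* A mismatch between neighboring blocks would be a forbidden pattern appearing in [z]. *)
have cy : consistent S2 l y.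
  move=> g t u tS ul tul; apply/eqP/negP => /negP ne.
  apply: (zF (z g, z (g * t), index t S2) _ g); last by rewrite /= nth_index.
  rewrite mem_block_forbidden /= !zn mem_indices // !andbT; apply/orP; left.
  apply/hasP; exists (index (t * u) l, index t S2, index u l); last by rewrite /= eqxx.
  apply/mapP; exists (t, u) => //; rewrite mem_filter /= tul.
  by apply/allpairsP; exists (t, u).
have ty := S2_tight cy.
have y1 g : y g 1 = digit n 0 (z g) by rewrite /y index1.
exists (fun g => y g 1); split=> /=.
- by move=> g; rewrite /y ltn_pmod.
- move=> q qF g [xq1 xq2].
  (* A forbidden pattern of [w] inside the block at [g] excludes every right neighbor, in particular
     the one in direction [s2]. *)
  apply: (zF (z g, z (g * s2), index s2 S2) _ g); last by rewrite /= nth_index.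
  rewrite mem_block_forbidden /= !zn mem_indices // !andbT; apply/orP; right.
  apply/hasP; exists q => //=; rewrite -y1 xq1 eqxx /=.
  have /andP[_ /allP/(_ _ qF) /and3P[_ _ /hasP[j jS /eqP /= ij]]] := wf.
  rewrite -ij in jS; rewrite nth_positions // -xq2.
  by rewrite -ty //; apply: S1l; have [] := nth_indices jS.
by apply: Qmono Qz => g /= zp; rewrite y1 zp.
Qed.

Lemma block_reduction_domino :
  pos_reduces (domino Q S1) (domino Q S2).
Proof.
exists R; split; first exact: computable_block_reduction.
move=> w; rewrite dominoE block_reductionP; split.
  move=> [wf [p [pn dp] yes]].
  exists [:: (w.1.1 ^ size l, forb w, p)%N].
    rewrite /block_reduction wf; apply/mapP; exists p => //.
    by rewrite mem_filter dp eqxx /= mem_rev mem_iota.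
  by move=> v /=; rewrite inE => /eqP ->; apply/dominoE.
case; rewrite /block_reduction; case: ifP => // wf F /mapP[p].
rewrite mem_filter mem_rev mem_iota /= add0n => /andP[/eqP dp pn] -> sub.
split=> //; exists p => //; apply/dominoE.
by apply: sub; rewrite /= mem_head.
Qed.

End Correctness.

(** * Application to the seeded and recurrent problems *)

Lemma domino_pos_reduces (G : groupType) (Q : set G -> Prop) (S1 S2 : seq G) :
  infinite_set [set: G]%classic -> generates S2 ->
  monotone Q -> partition_regular Q -> (forall A, Q A -> (A !=set0)%classic) ->
  pos_reduces (domino Q S1) (domino Q S2).
Proof.
move=> infG gen2 Qmono Qreg Qne.
have [s2 s2S2] := generates_neq0 infG gen2.
have [l [tl S1l]] := generates_tight S1 gen2.
apply: (block_reduction_domino Qmono Qreg Qne tl S1l _ _ s2S2).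
  exact: mem_head.
by rewrite /= eqxx.
Qed.

(** A set is the union of its [N] color classes, so it is finite if all of them are. *)
Lemma infinite_partition_regular (T : Type) : partition_regular (fun A : set T => infinite_set A).
Proof.
move=> A f N fN infA; apply: contrapT => /forallNP nQ; apply: infA.
have -> : A = (\bigcup_(p in `I_N) (A `&` [set g | f g = p]))%classic.
  apply/seteqP; split=> [g Ag|g [p _ []]//].
  by exists (f g); [exact: fN|].
apply: bigcup_finite; first exact: finite_II.
by move=> p _; apply: contrapT; exact: nQ.
Qed.

Lemma SDPE (G : groupType) (S : seq G) : SDP S = domino (fun A => A 1) S.
Proof. by []. Qed.

Lemma RDPE (G : groupType) (S : seq G) : RDP S = domino (fun A : set G => infinite_set A) S.
Proof. by []. Qed.

Theorem lemma12 (G : groupType) (G_infinite : infinite_set [set: G]%classic)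
    (S1 S2 : seq G) (S1_gen : generates S1) (S2_gen : generates S2) :
  pos_equiv (SDP S1) (SDP S2) /\ pos_equiv (RDP S1) (RDP S2).
Proof.
have sdp (S S' : seq G) : generates S' -> pos_reduces (SDP S) (SDP S').
  move=> gen; rewrite !SDPE; apply: domino_pos_reduces => //.
  - by move=> A B AB; exact: AB.
  (* For the seeded problem the class to keep is that of the identity, of color [f 1]. *)
  - by move=> A f N _ A1; exists (f 1).
  - by move=> A A1; exists 1.
have rdp (S S' : seq G) : generates S' -> pos_reduces (RDP S) (RDP S').
  move=> gen; rewrite !RDPE; apply: domino_pos_reduces => //.
  - exact: sub_infinite_set.
  - exact: infinite_partition_regular.
  - exact: infinite_setN0.
by split; split; [exact: sdp|exact: sdp|exact: rdp|exact: rdp].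
Qed.
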